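(* Let $n\ge1$, let $\iota:\mathfrak{S}_n\to\mathfrak{S}_n$, $\iota(\sigma)=\sigma^{-1}$, and let $\Phi^*=\Phi_{SZ}\circ\Phi_C^{-1}$. Then the mapping $\Theta:=\iota\circ\Phi^*\circ\iota:\mathfrak{S}_n\to\mathfrak{S}_n$ is a bijection such that for every $\sigma\in\mathfrak{S}_n$, $$(\mathrm{exc},\mathrm{nest}^*,\mathrm{cros}^*,\mathrm{depth})\,\sigma=(\mathrm{exc},\mathrm{cros}^*,\mathrm{nest}^*,\mathrm{depth})\,\Theta(\sigma).$$
   Context: $\mathfrak{S}_n$ is the set of permutations $\sigma=\sigma_1\cdots\sigma_n$ of $[n]$, $\sigma_i=\sigma(i)$. For a tuple of statistics, $(\mathrm{st}_1,\mathrm{st}_2,\dots)\,\sigma$ means $(\mathrm{st}_1(\sigma),\mathrm{st}_2(\sigma),\dots)$. $\mathrm{exc}(\sigma)=\#\{i:\sigma(i)>i\}$, $\mathrm{depth}(\sigma)=\sum_{\sigma(i)>i}(\sigma(i)-i)$, and $$\mathrm{cros}^*(\sigma)=\#\{(i,j)\in[n]^2:(i<j<\sigma_i<\sigma_j)\lor(\sigma_i<\sigma_j\le i<j)\},$$ $$\mathrm{nest}^*(\sigma)=\#\{(i,j)\in[n]^2:(i<j<\sigma_j<\sigma_i)\lor(\sigma_j<\sigma_i\le i<j)\}.$$ The maps $\Phi_C,\Phi_{SZ}$ (bijections of $\mathfrak{S}_n$). An index $i\in[n-1]$ is a descent of $\sigma$ if $\sigma_i>\sigma_{i+1}$; then $\sigma_i$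 is a descent top and $\sigma_{i+1}$ a descent bottom. A letter is a nondescent top (resp. nondescent bottom) if it is not a descent top (resp. not a descent bottom). For $k=\sigma_j\in[n]$, set $(31\!-\!2)_k(\sigma)=\#\{i: i+1<j,\ \sigma_{i+1}<k<\sigma_i\}$ and $(2\!-\!31)_k(\sigma)=\#\{i: j<i-1,\ \sigma_i<k<\sigma_{i-1}\}$. Given $\sigma\in\mathfrak{S}_n$, let $f_1<\cdots<f_m$ be its nondescent tops and $g_1<\cdots<g_r$ its descent tops in increasing order. Let $f'=f'_1\cdots f'_m$ be the unique arrangement of the nondescent bottoms of $\sigma$ such that $\#\{a<b: f'_a>f'_b\}=(31\!-\!2)_{f_b}(\sigma)$ for all $b$, and let $g'=g'_1\cdots g'_r$ be the unique arrangement of the descent bottoms of $\sigma$ such that $\#\{a>b: g'_a<g'_b\}=(31\!-\!2)_{g_b}(\sigma)$ for all $b$. Then $\Phi_C(\sigma)$ is the permutation $\tau$ with $\tau(f_b)=f'_b$ for all $b\in[m]$ and $\tau(g_b)=g'_b$ for all $b\in[r]$. The map $\Phi_{SZ}$ is defined in exactly the same way with $(2\!-\!31)_{f_b}(\sigma)$ and $(2\!-\!31)_{g_b}(\sigma)$ in place of $(31\!-\!2)_{f_b}(\sigma)$ and $(31\!-\!2)_{g_b}(\sigma)$. (Example: for $\sigma=412796583$, $\Phi_C(\sigma)=724183965$ and $\Phi_{SZ}(\sigma)=249385716$.) *)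

(* Defs.v *)
From mathcomp Require Import all_boot all_fingroup.

Set Implicit Arguments.
Unset Strict Implicit.
Unset Printing Implicit Defensive.

(* Permutations of [n] are elements of {perm 'I_n}: positions and letters are
   numbered from 0 instead of 1.  Every notion below only compares positions and
   letters, or uses their differences, so this shift changes nothing. *)

Section Statistics.

Variable n : nat.
Implicit Types s : {perm 'I_n}.

Definition exc s : nat := #|[set i : 'I_n | i < s i]|.

Definition depth s : nat := \sum_(i < n | i < s i) (s i - i).

Definition cros_star s : nat :=
  #|[set p : 'I_n * 'I_n | let: (i, j) := p in
       [&& i < j, j < s i & s i < s j] || [&& s i < s j, s j <= i & i < j]]|.

Definition nest_star s : nat :=
  #|[set p : 'I_n * 'I_n | let: (i, j) := p in
       [&& i < j, j < s j & s j < s i] || [&& s j < s i, s i <= i & i < j]]|.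

(* i is a descent of s, and i' is the position i + 1. *)
Definition descent_at s (i i' : 'I_n) : bool := (i.+1 == i' :> nat) && (s i' < s i).

Definition descent_tops s : {set 'I_n} :=
  [set k | [exists i, exists i', descent_at s i i' && (k == s i)]].

Definition descent_bottoms s : {set 'I_n} :=
  [set k | [exists i, exists i', descent_at s i i' && (k == s i')]].

Definition nondescent_tops s : {set 'I_n} := ~: descent_tops s.

Definition nondescent_bottoms s : {set 'I_n} := ~: descent_bottoms s.

(* (31-2)_k: i' is the position i + 1, and (s^-1)%g k is the position j of k. *)
Definition pat31_2 s (k : 'I_n) : nat :=
  #|[set i : 'I_n | [exists i' : 'I_n,
       [&& i.+1 == i' :> nat, i' < (s^-1)%g k, s i' < k & k < s i]]]|.

(* (2-31)_k: i' is the position i - 1, and (s^-1)%g k is the position j of k. *)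
Definition pat2_31 s (k : 'I_n) : nat :=
  #|[set i : 'I_n | [exists i' : 'I_n,
       [&& i'.+1 == i :> nat, (s^-1)%g k < i', s i < k & k < s i']]]|.

Definition arrangement_of m (B : {set 'I_n}) (w : {ffun 'I_m -> 'I_n}) : bool :=
  injectiveb w && ([set w b | b : 'I_m] == B).

(* t is obtained from s when the inversions are prescribed by c = pat31_2 or
   c = pat2_31.  Since enum lists ordinals in increasing order, the sequences
   f_b and g_b of the letters of a set in increasing order are enum_val. *)
Definition Phi_spec (c : {perm 'I_n} -> 'I_n -> nat) s (t : {perm 'I_n}) : bool :=
  let F := nondescent_tops s in
  let G := descent_tops s in
  let f := fun b : 'I_#|F| => enum_val b in
  let g := fun b : 'I_#|G| => enum_val b in
  [exists f' : {ffun 'I_#|F| -> 'I_n}, exists g' : {ffun 'I_#|G| -> 'I_n},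
    [&& arrangement_of (nondescent_bottoms s) f',
        [forall b : 'I_#|F|, #|[set a : 'I_#|F| | (a < b) && (f' b < f' a)]| == c s (f b)],
        arrangement_of (descent_bottoms s) g',
        [forall b : 'I_#|G|, #|[set a : 'I_#|G| | (b < a) && (g' a < g' b)]| == c s (g b)],
        [forall b, t (f b) == f' b]
      & [forall b, t (g b) == g' b]]].

(* The default value 1 is never used: the arrangements f' and g' exist and are
   unique for every s, hence so is the permutation satisfying Phi_spec. *)
Definition Phi (c : {perm 'I_n} -> 'I_n -> nat) s : {perm 'I_n} :=
  odflt 1%g [pick t | Phi_spec c s t].

Definition Phi_C : {perm 'I_n} -> {perm 'I_n} := Phi pat31_2.

Definition Phi_SZ : {perm 'I_n} -> {perm 'I_n} := Phi pat2_31.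

Definition iota_perm s : {perm 'I_n} := (s^-1)%g.

(* finv is the inverse of an injective self-map of a finite type. *)
Definition Phi_star : {perm 'I_n} -> {perm 'I_n} := Phi_SZ \o finv Phi_C.

Definition Theta : {perm 'I_n} -> {perm 'I_n} := iota_perm \o Phi_star \o iota_perm.

End Statistics.

(* Main.v *)
Require Import Defs.
From mathcomp Require Import all_boot all_fingroup zify.

Set Implicit Arguments.
Unset Strict Implicit.
Unset Printing Implicit Defensive.

(** Write [h k] for the number of descents straddling the letter [k], that is
    going from a letter above [k] to a letter below [k].  Such a descent lies
    either left or right of [k], so (31-2)_k + (2-31)_k = [h k].  Moreover the
    descents with top above [k] have their bottom below [k] (straddling) or at
    least [k], so [h k] depends only on the sets of descent tops and descent
    bottoms of the permutation.

    The weak exceedances of the permutation [t = Phi c s] are exactly at the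
    nondescent tops of [s]: the bound [c s k <= h k] forces this by counting
    ([realizes_anti_exc]).  Hence the inversions prescribed by [c] are the
    nestings of [t] at the letter [k], and the crossings of [t] at [k] make up
    the remainder [h k - c s k] ([realizes_nest_at], [realizes_cros_at]); taking
    the inverse turns these local nestings and crossings into the starred
    statistics.  So if [s] is the inverse of [Phi_C r], then its nestings number
    the sum of the (31-2)_k of [r] and its crossings the sum of the (2-31)_k,
    while for the inverse of [Phi_SZ r], which is [Theta s], the two sums are
    exchanged.  The number of exceedances and the depth depend on the descent
    tops and bottoms of [r] only, hence agree.

    The map [Theta] is a bijection once [Phi_C] and [Phi_SZ] are injective.  The
    permutation [Phi c s] gives back the descent tops, the descent bottoms and
    the function [c s], so what is left is that these data determine [s]
    ([pat31_2_determines]).  The letters are inserted in increasing order: at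
    stage [m] each maximal run of letters [>= m] is a slot, the end of the word
    counting as a large letter; (31-2)_m says in which slot the letter [m] goes,
    and part of that slot survives to the left of [m] if and only if [m] is a
    descent bottom, to its right if and only if [m] is not a descent top. *)

(** * Counting lemmas *)

Lemma card_image_sub (T U : finType) (A : {set T}) (f : T -> U) (P : pred U) :
  {in A &, injective f} ->
  #|[set y in f @: A | P y]| = #|[set x in A | P (f x)]|.
Proof.
move=> finj; rewrite -(card_in_imset (f := f) (D := [set x in A | P (f x)])); last first.
  by move=> x y; rewrite !inE => /andP[xA _] /andP[yA _]; apply: finj.
congr #|pred_of_set _|; apply/setP=> y; rewrite inE; apply/andP/imsetP.
  by case=> /imsetP[x xA ->] Px; exists x; rewrite // inE xA.
by case=> x; rewrite inE => /andP[xA Px] ->; split=> //; apply: imset_f.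
Qed.

Lemma card_sub_split (T : finType) (A : {set T}) (P Q : pred T) :
  #|[set x in A | P x]| =
    #|[set x in A | P x && Q x]| + #|[set x in A | P x && ~~ Q x]|.
Proof.
rewrite -(cardsID [set x | Q x] [set x in A | P x]); congr (_ + _);
  congr #|pred_of_set _|; apply/setP=> x; rewrite !inE;
  by case: (x \in A); case: (P x); case: (Q x).
Qed.

Lemma card_pairs (T U : finType) (P : T -> U -> bool) :
  #|[set p : T * U | let: (i, j) := p in P i j]| = \sum_i \sum_j P i j.
Proof.
rewrite pair_bigA /= -sum1dep_card big_mkcond /=.
by apply: eq_bigr => -[i j] _ /=; case: (P i j).
Qed.

Lemma card_as_sum (T : finType) (P : pred T) : #|[set a | P a]| = \sum_a P a.
Proof. by rewrite -sum1dep_card big_mkcond /=; apply: eq_bigr => a _; case: (P a). Qed.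

Lemma card_eq_cond (T : finType) (A : {set T}) (k : T) (P : pred T) :
  #|[set a in A | (a == k) && P a]| = (k \in A) && P k.
Proof.
case: (boolP (_ && _)) => [/andP[kA Pk]|kn] /=.
  apply/eqP/cards1P; exists k; apply/setP=> a; rewrite !inE.
  by case: eqVneq => [->|]; rewrite ?kA ?Pk ?andbF.
apply: eq_card0 => a; rewrite !inE; case: eqVneq => [->|]; rewrite ?andbF //=.
exact: negPf.
Qed.

Lemma card_lt_ord n (i : 'I_n) : #|[set j : 'I_n | j < i]| = i.
Proof.
rewrite -sum1dep_card -(big_ord_widen n (fun=> 1)) ?sum1_card ?card_ord //.
exact: ltnW.
Qed.

(** * Descents straddling a letter *)

Section Descents.

Variable n : nat.
Implicit Types (s t : {perm 'I_n}) (k x : 'I_n).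

(** Each descent is kept as the pair of its two adjacent positions, so that its
    top and its bottom are both functions of it. *)
Definition descents s : {set 'I_n * 'I_n} := [set p | descent_at s p.1 p.2].

Definition straddling s k : {set 'I_n * 'I_n} :=
  [set p in descents s | s p.2 < k < s p.1].

Lemma descents_top_inj s : {in descents s &, injective (fun p => s p.1)}.
Proof.
move=> [i i'] [j j']; rewrite !inE /= => /andP[/eqP hi _] /andP[/eqP hj _].
by move=> /perm_inj eij; congr pair => //; apply: val_inj; rewrite /= -hi -hj eij.
Qed.

Lemma descents_bottom_inj s : {in descents s &, injective (fun p => s p.2)}.
Proof.
move=> [i i'] [j j']; rewrite !inE /= => /andP[/eqP hi _] /andP[/eqP hj _].
move=> /perm_inj eij; congr pair => //; apply: val_inj.
by apply: succn_inj; rewrite /= hi hj eij.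
Qed.

Lemma descent_topsE s : descent_tops s = [set s p.1 | p in descents s].
Proof.
apply/setP=> k; rewrite inE; apply/existsP/imsetP=> [[i /existsP[i' /andP[d /eqP ->]]]|].
  by exists (i, i'); rewrite ?inE.
by case=> [[i i']]; rewrite inE /= => d ->; exists i; apply/existsP; exists i'; rewrite d eqxx.
Qed.

Lemma descent_bottomsE s : descent_bottoms s = [set s p.2 | p in descents s].
Proof.
apply/setP=> k; rewrite inE; apply/existsP/imsetP=> [[i /existsP[i' /andP[d /eqP ->]]]|].
  by exists (i, i'); rewrite ?inE.
by case=> [[i i']]; rewrite inE /= => d ->; exists i; apply/existsP; exists i'; rewrite d eqxx.
Qed.

Lemma pat31_2E s k :
  pat31_2 s k = #|[set p in straddling s k | p.2 < (s^-1)%g k]|.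
Proof.
rewrite -(card_in_imset (f := fst)); last first.
  move=> p q /setIdP[/setIdP[dp _] _] /setIdP[/setIdP[dq _] _] e.
  by apply: (descents_top_inj dp dq); congr (s _).
congr #|pred_of_set _|; apply/setP=> i; rewrite inE; apply/existsP/imsetP.
  case=> i' /and4P[e lt1 lt2 lt3]; exists (i, i') => //.
  by rewrite !inE /= /descent_at; lia.
by case=> [[j i']]; rewrite !inE /= /descent_at => h ->; exists i'; lia.
Qed.

Lemma pat2_31E s k :
  pat2_31 s k = #|[set p in straddling s k | (s^-1)%g k < p.1]|.
Proof.
rewrite -(card_in_imset (f := snd)); last first.
  move=> p q /setIdP[/setIdP[dp _] _] /setIdP[/setIdP[dq _] _] e.
  by apply: (descents_bottom_inj dp dq); congr (s _).
congr #|pred_of_set _|; apply/setP=> i; rewrite inE; apply/existsP/imsetP.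
  case=> i' /and4P[e lt1 lt2 lt3]; exists (i', i) => //.
  by rewrite !inE /= /descent_at; lia.
by case=> [[i' j]]; rewrite !inE /= /descent_at => h ->; exists i'; lia.
Qed.

(** The two positions of a straddling descent are adjacent and neither carries the
    letter [k], so the descent lies strictly on one side of [k]. *)
Lemma pat_add s k : pat31_2 s k + pat2_31 s k = #|straddling s k|.
Proof.
rewrite pat31_2E pat2_31E.
rewrite -(cardsID [set p : 'I_n * 'I_n | p.2 < (s^-1)%g k] (straddling s k)).
congr (_ + _); congr #|pred_of_set _|; apply/setP=> -[i i']; rewrite !inE /descent_at /=.
  by lia.
have ni : k < s i -> i != (s^-1)%g k :> nat.
  by apply: contraTneq => /val_inj ->; rewrite permKV ltnn.
have ni' : s i' < k -> i' != (s^-1)%g k :> nat.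
  by apply: contraTneq => /val_inj ->; rewrite permKV ltnn.
lia.
Qed.

(** Among the descents with top above [k], those that do not straddle [k] have
    their bottom at least [k]. *)
Lemma straddling_tops s k :
  #|straddling s k| + #|[set b in descent_bottoms s | k <= b]| =
  #|[set a in descent_tops s | k < a]|.
Proof.
rewrite descent_topsE descent_bottomsE.
rewrite (card_image_sub (fun b : 'I_n => k <= b) (@descents_bottom_inj s)).
rewrite (card_image_sub (fun b : 'I_n => k < b) (@descents_top_inj s)).
rewrite [RHS](card_sub_split _ _ (fun p => s p.2 < k)).
congr (_ + _); congr #|pred_of_set _|; apply/setP=> -[i i'];
  rewrite !inE /= /descent_at; lia.
Qed.

Lemma card_tops_bottoms s : #|descent_tops s| = #|descent_bottoms s|.
Proof.
rewrite descent_topsE descent_bottomsE card_in_imset; last exact: descents_top_inj.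
by rewrite card_in_imset //; exact: descents_bottom_inj.
Qed.

(** This is [straddling_tops] after complementation: there are as many descent
    tops as descent bottoms, and [k] itself is not a descent top. *)
Lemma straddling_nontops s k : k \in nondescent_tops s ->
  #|straddling s k| + #|[set b in nondescent_bottoms s | b < k]| =
  #|[set a in nondescent_tops s | a < k]|.
Proof.
rewrite inE => kF; have := straddling_tops s k; have := card_tops_bottoms s.
have split_tot (A : {set 'I_n}) : 
    #|A| = #|[set a in A | a < k]| + #|[set a in A | k <= a]|.
  have := card_sub_split A predT (fun a => a < k).
  rewrite /= => e; transitivity #|[set x in A | true]|.
    by congr #|pred_of_set _|; apply/setP=> x; rewrite inE andbT.
  rewrite e; congr (_ + _); congr #|pred_of_set _|; apply/setP=> x; rewrite !inE //.
  by rewrite -leqNgt.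
have split_lt (A : {set 'I_n}) : 
    #|[set a in A | a < k]| + #|[set a in ~: A | a < k]| = #|[set a : 'I_n | a < k]|.
  rewrite -(cardsID A [set a : 'I_n | a < k]).
  by congr (_ + _); congr #|pred_of_set _|; apply/setP=> x; rewrite !inE // andbC.
rewrite (split_tot (descent_tops s)) (split_tot (descent_bottoms s)).
have -> : [set a in descent_tops s | k <= a] = [set a in descent_tops s | k < a].
  apply/setP=> a; rewrite !inE leq_eqVlt; case: eqVneq => [/val_inj e|] //=.
  by move: kF; rewrite e inE => /negPf ->.
have := split_lt (descent_tops s); have := split_lt (descent_bottoms s).
rewrite /nondescent_tops /nondescent_bottoms; lia.
Qed.

End Descents.

(** * Arrangements with prescribed inversions *)

(** The keys [u] and [v] carry the orders on positions and on values; taking both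
    decreasing reduces the inversions counted from the right to those counted
    from the left. *)
Section Arrangements.

Variables (T : finType) (u v : T -> nat).
Hypotheses (u_inj : injective u) (v_inj : injective v).

Lemma exists_rank (B : {set T}) c : c < #|B| ->
  exists2 x, x \in B & #|[set y in B | v x < v y]| = c.
Proof.
elim: c B => [|c IH] B hc; have /card_gt0P[x0 x0B] : 0 < #|B| by lia.
  case: (@arg_maxnP T x0 (mem B) v x0B) => x xB xmax; exists x => //.
  apply: eq_card0 => y; rewrite !inE; apply/negP => /andP[yB].
  by rewrite ltnNge => /negP; apply; apply: xmax.
case: (@arg_maxnP T x0 (mem B) v x0B) => m; rewrite -[mem B m]/(m \in B) => mB mmax.
have := cardsD1 m B; rewrite mB => eB.
have [|x] := IH (B :\ m); first by rewrite eB in hc; lia.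
rewrite !inE => /andP[xm xB] ex; exists x => //.
rewrite (cardsD1 m) !inE mB /=.
have -> : v x < v m.
  by rewrite ltn_neqAle (inj_eq v_inj) xm; apply: mmax.
rewrite -ex add1n; congr S; congr #|pred_of_set _|; apply/setP=> y.
by rewrite !inE andbA.
Qed.

(** The last position must receive the value that has exactly the prescribed
    number of larger values; remove both and recurse. *)
Lemma exists_arrangement (A B : {set T}) (c : T -> nat) :
  #|A| = #|B| -> (forall k, k \in A -> c k <= #|[set a in A | u a < u k]|) ->
  exists w : T -> T, [/\ {in A &, injective w}, w @: A = B &
    forall k, k \in A -> #|[set a in A | (u a < u k) && (v (w k) < v (w a))]| = c k].
Proof.
elim: {A}#|A| {-2}A (erefl #|A|) B => [|m IH] A eA B eB hc.
  move/eqP: eA; rewrite cards_eq0 => /eqP A0; subst A.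
  exists id; split=> [x|| x]; rewrite ?inE //.
  by rewrite imset0; apply/esym/eqP; rewrite -cards_eq0 -eB cards0.
have /card_gt0P[x0 x0A] : 0 < #|A| by rewrite eA.
case: (@arg_maxnP T x0 (mem A) u x0A) => z; rewrite -[mem A z]/(z \in A) => zA zmax.
have lt_z a : a \in A -> a != z -> u a < u z.
  by move=> aA az; rewrite ltn_neqAle (inj_eq u_inj) az; apply: zmax.
have eAz : [set a in A | u a < u z] = A :\ z.
  apply/setP=> a; rewrite !inE andbC; case: eqVneq => [->|az] /=; first by rewrite ltnn.
  by case: (boolP (a \in A)) => aA; rewrite ?andbF // lt_z.
have := cardsD1 z A; rewrite zA eA => eAD.
(* The hypothesis on [c] leaves room for a value of rank [c z] in [B]. *)
have [|x xB ex] := @exists_rank B (c z); first by have := hc z zA; rewrite eAz -eB; lia.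
have := cardsD1 x B; rewrite xB -eB => eBD.
have [|||w [winj wim wc]] := IH (A :\ z) _ (B :\ x).
- lia.
- lia.
- move=> k; rewrite !inE => /andP[kz kA]; apply: leq_trans (hc k kA) _.
  apply: subset_leq_card; apply/subsetP=> a; rewrite !inE => /andP[-> lta]; rewrite lta !andbT.
  by apply: contraTneq lta => ->; rewrite -leqNgt; apply: zmax.
pose w' a := if a == z then x else w a.
have w'z : w' z = x by rewrite /w' eqxx.
have w'E a : a != z -> w' a = w a by rewrite /w' => /negPf ->.
have w'im : w' @: (A :\ z) = B :\ x.
  by rewrite -wim; apply: eq_in_imset => a; rewrite !inE => /andP[az _]; apply: w'E.
have winD a : a \in A -> a != z -> w' a \in B :\ x.
  by move=> aA az; rewrite -w'im; apply: imset_f; rewrite !inE az.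
exists w'; split.
- move=> a b aA bA; case: (eqVneq a z) (eqVneq b z) => [->|az] [->|bz] //.
  + by rewrite w'z => e; have := winD b bA bz; rewrite -e !inE eqxx.
  + by rewrite w'z => e; have := winD a aA az; rewrite e !inE eqxx.
  + by rewrite !w'E // => /winj; apply; rewrite !inE ?az ?bz.
- by rewrite -(setD1K zA) imsetU1 w'z w'im setD1K.
- move=> k kA; case: (eqVneq k z) => [->|kz].
    rewrite w'z -ex.
    have -> : [set y in B | v x < v y] = [set y in w' @: (A :\ z) | v x < v y].
      apply/setP=> y; rewrite w'im !inE; case: eqVneq => [->|] //=.
      by rewrite ltnn andbF.
    rewrite card_image_sub; last first.
      move=> a b; rewrite !inE => /andP[az aA] /andP[bz bA]; rewrite !w'E // => /winj.
      by apply; rewrite !inE ?az ?bz.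
    by congr #|pred_of_set _|; rewrite -eAz; apply/setP=> a; rewrite !inE andbA.
  rewrite -wc ?inE ?kz //; congr #|pred_of_set _|; apply/setP=> a; rewrite !inE w'E //.
  case: eqVneq => [->|az] /=; last by rewrite w'E.
  by case: ltnP; rewrite ?andbF // => lt; have := zmax k kA; lia.
Qed.

End Arrangements.

(** * The images of a permutation under Phi *)

Section Realization.

Variable n : nat.
Implicit Types (s t : {perm 'I_n}) (k x : 'I_n) (c : 'I_n -> nat).

(** [Phi_spec] without the enumerations: the word [f'] is the restriction of [t]
    to the nondescent tops, and [g'] its restriction to the descent tops. *)
Definition realizes c s t : Prop :=
  [/\ t @: nondescent_tops s = nondescent_bottoms s,
      forall k, k \in nondescent_tops s ->
        #|[set a in nondescent_tops s | (a < k) && (t k < t a)]| = c k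
    & forall k, k \in descent_tops s ->
        #|[set a in descent_tops s | (k < a) && (t a < t k)]| = c k].

(** The enumeration of a set of ordinals is increasing because it is a
    subsequence of [0, ..., n - 1]. *)
Lemma enum_val_lt (A : {set 'I_n}) (a b : 'I_#|A|) :
  (enum_val a < enum_val b) = (a < b).
Proof.
have mono (i j : 'I_#|A|) : i < j -> enum_val i < enum_val j.
  move=> ij; have x0 := enum_val i.
  have srt : sorted ltn (map val (enum A)).
    rewrite /enum_mem -enumT.
    apply: (subseq_sorted ltn_trans (map_subseq _ (filter_subseq _ _))).
    by rewrite val_enum_ord iota_ltn_sorted.
  have := sorted_ltn_nth ltn_trans (val x0) srt.
  move=> /(_ i j); rewrite !inE size_map -cardE => /(_ (ltn_ord i) (ltn_ord j) ij).
  by rewrite !(nth_map x0) -?cardE // -!enum_val_nth.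
apply/idP/idP; last exact: mono.
apply: contraTT; rewrite -!leqNgt leq_eqVlt => /orP[/eqP/val_inj -> //|/mono].
exact: ltnW.
Qed.

Lemma card_enum_val (A : {set 'I_n}) (P : pred 'I_n) :
  #|[set a : 'I_#|A| | P (enum_val a)]| = #|[set x in A | P x]|.
Proof.
rewrite -(card_imset _ enum_val_inj); congr #|pred_of_set _|.
apply/setP=> x; rewrite inE; apply/imsetP/andP.
  by case=> a; rewrite inE => Pa ->; rewrite enum_valP.
by case=> xA Px; exists (enum_rank_in xA x); rewrite ?inE enum_rankK_in.
Qed.

Lemma imset_enum_val (A : {set 'I_n}) (f : 'I_n -> 'I_n) :
  [set f (enum_val b) | b : 'I_#|A|] = f @: A.
Proof.
apply/setP=> y; apply/imsetP/imsetP.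
  by case=> b _ ->; exists (enum_val b); rewrite ?enum_valP.
by case=> x xA ->; exists (enum_rank_in xA x); rewrite // enum_rankK_in.
Qed.

Lemma realizes_tops c s t : realizes c s t ->
  t @: descent_tops s = descent_bottoms s.
Proof.
case=> im _ _; rewrite -[descent_tops s]setCK -[descent_bottoms s]setCK.
rewrite -/(nondescent_bottoms s) -im; apply/setP=> y; rewrite inE.
rewrite -[y](permKV t) !mem_imset ?inE //; exact: perm_inj.
Qed.

Lemma Phi_specP (c : {perm 'I_n} -> 'I_n -> nat) s t :
  reflect (realizes (c s) s t) (Phi_spec c s t).
Proof.
apply: (iffP existsP) => [[f' /existsP[g']]|R].
  case/and5P=> /andP[_ /eqP imf] /forallP hf _ /forallP hg /andP[/forallP tf /forallP tg].
  split.
  - rewrite -imset_enum_val -imf; apply: eq_imset => b; exact/eqP/tf.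
  - move=> k kF; have := hf (enum_rank_in kF k).
    rewrite enum_rankK_in // => /eqP <-.
    rewrite -(card_enum_val _ (fun a => (a < k) && (t k < t a))).
    congr #|pred_of_set _|; apply/setP=> a; rewrite !inE -enum_val_lt.
    by rewrite -!(eqP (tf _)) enum_rankK_in.
  - move=> k kF; have := hg (enum_rank_in kF k).
    rewrite enum_rankK_in // => /eqP <-.
    rewrite -(card_enum_val _ (fun a => (k < a) && (t a < t k))).
    congr #|pred_of_set _|; apply/setP=> a; rewrite !inE -enum_val_lt.
    by rewrite -!(eqP (tg _)) enum_rankK_in.
have imG := realizes_tops R; case: R => imF hF hG.
exists [ffun b => t (enum_val b)]; apply/existsP; exists [ffun b => t (enum_val b)].
apply/and5P; split; last (apply/andP; split).
- apply/andP; split.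
    by apply/injectiveP=> a b; rewrite !ffunE => /perm_inj/enum_val_inj.
  by rewrite -imF -imset_enum_val; apply/eqP/eq_imset => b; rewrite ffunE.
- apply/forallP=> b; rewrite -hF ?enum_valP // -card_enum_val; apply/eqP.
  by congr #|pred_of_set _|; apply/setP=> a; rewrite !inE !ffunE enum_val_lt.
- apply/andP; split.
    by apply/injectiveP=> a b; rewrite !ffunE => /perm_inj/enum_val_inj.
  by rewrite -imG -imset_enum_val; apply/eqP/eq_imset => b; rewrite ffunE.
- apply/forallP=> b; rewrite -hG ?enum_valP // -card_enum_val; apply/eqP.
  by congr #|pred_of_set _|; apply/setP=> a; rewrite !inE !ffunE enum_val_lt.
- by apply/forallP=> b; rewrite ffunE.
- by apply/forallP=> b; rewrite ffunE.
Qed.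

(** Since [straddling_tops] and [straddling_nontops] bound the number of
    straddling descents by the number of available positions, the inversions can
    be prescribed separately on the nondescent tops and on the descent tops. *)
Lemma realizes_exists c s : (forall k, c k <= #|straddling s k|) ->
  exists t, realizes c s t.
Proof.
move=> hc; set F := nondescent_tops s; set G := descent_tops s.
have cardG : #|G| = #|descent_bottoms s| := card_tops_bottoms s.
have cardF : #|F| = #|nondescent_bottoms s|.
  by rewrite [LHS]cardsCs [RHS]cardsCs !setCK -/G cardG.
have [|wF [injF imF cF]] := exists_arrangement (@ord_inj n) (@ord_inj n) (c := c) cardF.
  move=> k kF; apply: leq_trans (hc k) _.
  by rewrite -(straddling_nontops kF) leq_addr.
(* On the descent tops, inversions are counted from the right. *)
have rev_inj : injective (fun a : 'I_n => n - a).
  by move=> a b e; apply: val_inj; have := ltn_ord a; have := ltn_ord b; move: e => /=; lia.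
have revE (a b : 'I_n) : (n - a < n - b) = (b < a).
  by have := ltn_ord a; have := ltn_ord b; lia.
have [|wG [injG imG cG]] := exists_arrangement rev_inj rev_inj (c := c) cardG.
  move=> k kG; apply: leq_trans (hc k) _.
  apply: leq_trans (leq_addr #|[set b in descent_bottoms s | k <= b]| _) _.
  rewrite straddling_tops.
  by apply: subset_leq_card; apply/subsetP=> a; rewrite !inE revE.
pose w a := if a \in G then wG a else wF a.
have wGE a : a \in G -> w a = wG a by rewrite /w => ->.
have wFE a : a \in F -> w a = wF a by rewrite inE /w => /negPf ->.
have FG a : (a \in F) = (a \notin G) by rewrite inE.
have inG a : a \in G -> wG a \in descent_bottoms s by move=> aG; rewrite -imG imset_f.
have inF a : a \in F -> wF a \notin descent_bottoms s.
  by move=> aF; rewrite -in_setC -/(nondescent_bottoms s) -imF imset_f.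
have winj : injective w.
  move=> a b; case: (boolP (a \in G)) (boolP (b \in G)) => [aG|aF] [bG|bF].
  - by rewrite !wGE //; apply: injG.
  - by rewrite -FG in bF; rewrite (wGE a) // (wFE b) // => e; have := inF b bF; rewrite -e inG.
  - by rewrite -FG in aF; rewrite (wGE b) // (wFE a) // => e; have := inF a aF; rewrite e inG.
  - by rewrite -FG in aF; rewrite -FG in bF; rewrite !wFE //; apply: injF.
exists (perm winj); split.
- by rewrite -imF; apply: eq_in_imset => a aF; rewrite permE wFE.
- move=> k kF; rewrite -cF //; congr #|pred_of_set _|; apply/setP=> a.
  by rewrite [LHS]in_set [RHS]in_set -/F; case: (boolP (a \in F)) => //= aF;
  rewrite !permE !wFE.
- move=> k kG; rewrite -cG //; congr #|pred_of_set _|; apply/setP=> a.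
  by rewrite [LHS]in_set [RHS]in_set -/G; case: (boolP (a \in G)) => //= aG;
  rewrite !permE !wGE // !revE.
Qed.

Lemma PhiP (c : {perm 'I_n} -> 'I_n -> nat) s :
  (forall k, c s k <= #|straddling s k|) -> realizes (c s) s (Phi c s).
Proof.
move=> /realizes_exists[t /Phi_specP st]; rewrite /Phi; case: pickP => [u /Phi_specP //|].
by move=> /(_ t); rewrite st.
Qed.

(** At a descent top [k], at least as many descent tops [a > k] satisfy
    [t a > t k] as there are descent bottoms [>= k].  If [t k >= k], the values of
    [t] at these [a] and at [k] itself would be too many descent bottoms [>= k].
    Nondescent tops are treated symmetrically. *)
Lemma realizes_anti_exc c s t k :
  (forall k, c k <= #|straddling s k|) -> realizes c s t ->
  (t k < k) = (k \in descent_tops s).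
Proof.
move=> hc R; have imG := realizes_tops R; case: R => imF hF hG.
apply/idP/idP => [|kG]; last first.
  rewrite ltnNge; apply/negP => le_k.
  have := straddling_tops s k; have := hc k; rewrite -hG // -imG.
  rewrite card_image_sub; last by move=> a b _ _; apply: perm_inj.
  rewrite (card_sub_split (descent_tops s) (fun a : 'I_n => k < a) (fun a => t a < t k)).
  set X := [set a : 'I_n in _ | (k < a) && ~~ _]; set Y := [set a : 'I_n in _ | k <= t a].
  have : k |: X \subset Y.
    apply/subsetP=> a /setU1P[->|/setIdP[aG /andP[_ le]]]; apply/setIdP; split=> //.
    by rewrite -leqNgt in le; apply: leq_trans le.
  have kX : k \notin X by rewrite in_set ltnn andbF.
  move/subset_leq_card; rewrite cardsU1 kX add1n => lt_XY le_c eq_c.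
  by move: (leq_add le_c lt_XY); rewrite addnS eq_c ltnn.
apply: contraTT => nkG; rewrite -leqNgt leqNgt; apply/negP => lt_k.
have kF : k \in nondescent_tops s by rewrite inE.
have := straddling_nontops kF; have := hc k; rewrite -hF // -imF.
rewrite card_image_sub; last by move=> a b _ _; apply: perm_inj.
rewrite (card_sub_split (nondescent_tops s) (fun a : 'I_n => a < k) (fun a => t k < t a)).
set X := [set a : 'I_n in _ | (a < k) && ~~ _]; set Y := [set a : 'I_n in _ | t a < k].
have : k |: X \subset Y.
  apply/subsetP=> a /setU1P[->|/setIdP[aF /andP[_ le]]]; apply/setIdP; split=> //.
  by rewrite -leqNgt in le; apply: leq_ltn_trans le lt_k.
have kX : k \notin X by rewrite in_set ltnn andbF.
move/subset_leq_card; rewrite cardsU1 kX add1n => lt_XY le_c eq_c.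
by move: (leq_add le_c lt_XY); rewrite addnS eq_c ltnn.
Qed.

End Realization.

(** * Crossings, nestings, exceedances and depth of the inverse *)

Section Transport.

Variable n : nat.
Implicit Types (s t : {perm 'I_n}) (k x : 'I_n) (c : 'I_n -> nat).

(** Each starred nesting or crossing of the inverse of [t] involves two positions
    [a] and [k] of [t]; it is charged to the one, [k], that lies between [a] and
    [t a].  The first term counts anti-exceedances, the second weak exceedances. *)
Definition nest_at t k := \sum_a
  ([&& t a < t k, t k < k & k < a] + [&& a < k, k <= t k & t k < t a]).

Definition cros_at t k := \sum_a
  ([&& t k < t a, t a < k & k < a] + [&& a < k, k <= t a & t a < t k]).

Lemma nest_starV t : nest_star (t^-1)%g = \sum_k nest_at t k.
Proof.
rewrite /nest_star card_pairs (reindex_inj (@perm_inj _ t)) /=.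
under eq_bigr => p _ do rewrite (reindex_inj (@perm_inj _ t)) /=.
pose A (p q : 'I_n) : nat := [&& t p < t q, t q < q & q < p].
pose B (p q : 'I_n) : nat := [&& q < p, p <= t p & t p < t q].
transitivity (\sum_p \sum_q (A p q + B p q)).
  by apply: eq_bigr => p _; apply: eq_bigr => q _; rewrite !permK /A /B; lia.
under eq_bigr do rewrite big_split /=.
rewrite big_split /= [X in X + _]exchange_big /= -big_split; apply: eq_bigr => k _ /=.
by rewrite -big_split.
Qed.

Lemma cros_starV t : cros_star (t^-1)%g = \sum_k cros_at t k.
Proof.
rewrite /cros_star card_pairs (reindex_inj (@perm_inj _ t)) /=.
under eq_bigr => p _ do rewrite (reindex_inj (@perm_inj _ t)) /=.
pose A (p q : 'I_n) : nat := [&& t p < t q, t q < p & p < q].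
pose B (p q : 'I_n) : nat := [&& p < q, q <= t p & t p < t q].
transitivity (\sum_p \sum_q (A p q + B p q)).
  by apply: eq_bigr => p _; apply: eq_bigr => q _; rewrite !permK /A /B; lia.
under eq_bigr do rewrite big_split /=.
rewrite big_split /= [X in _ + X]exchange_big /= -big_split; apply: eq_bigr => k _ /=.
by rewrite -big_split.
Qed.

Section Realized.

Variables (c : 'I_n -> nat) (s t : {perm 'I_n}).
Hypotheses (hc : forall k, c k <= #|straddling s k|) (R : realizes c s t).

Let topsE k : (k \in descent_tops s) = (t k < k).
Proof. by rewrite (realizes_anti_exc k hc R). Qed.

Let nontopsE k : (k \in nondescent_tops s) = (k <= t k).
Proof. by rewrite in_setC topsE -leqNgt. Qed.

(** The second index [a] of a nesting is on the same side of the diagonal as [k],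
    hence lies automatically among the tops (or nontops) counted by [c]. *)
Lemma realizes_nest_at k : nest_at t k = c k.
Proof.
case: R => _ hF hG; case: (ltnP (t k) k) => lt_k.
  rewrite -hG ?topsE // card_as_sum; apply: eq_bigr => a _; rewrite topsE; lia.
rewrite -hF ?nontopsE // card_as_sum; apply: eq_bigr => a _; rewrite nontopsE; lia.
Qed.

(** At an anti-exceedance [k], the anti-exceedances [a > k] are nested with [k],
    cross [k], or satisfy [t a >= k]; by [straddling_tops] the first two kinds
    number as many as the descents straddling [k].  The case of a weak exceedance
    is symmetric. *)
Lemma realizes_cros_at k : cros_at t k + c k = #|straddling s k|.
Proof.
have t_inj a : t a = t k :> nat -> a = k :> nat by move=> /val_inj/perm_inj ->.
rewrite -realizes_nest_at; case: (ltnP (t k) k) => lt_k.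
  apply: (@addIn #|[set b in descent_bottoms s | k <= b]|).
  rewrite straddling_tops -(realizes_tops R).
  rewrite card_image_sub; last by move=> a b _ _; apply: perm_inj.
  rewrite !card_as_sum -!big_split; apply: eq_bigr => a _ /=; rewrite topsE.
  by have := t_inj a; lia.
have kF : k \in nondescent_tops s by rewrite nontopsE.
apply: (@addIn #|[set b in nondescent_bottoms s | b < k]|).
rewrite (straddling_nontops kF); case: R => <- _ _.
rewrite card_image_sub; last by move=> a b _ _; apply: perm_inj.
rewrite !card_as_sum -!big_split; apply: eq_bigr => a _ /=; rewrite nontopsE.
by have := t_inj a; lia.
Qed.

Lemma realizes_nest_star : nest_star (t^-1)%g = \sum_k c k.
Proof. by rewrite nest_starV; apply: eq_bigr => k _; rewrite realizes_nest_at. Qed.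

Lemma realizes_cros_star : cros_star (t^-1)%g + \sum_k c k = \sum_k #|straddling s k|.
Proof.
by rewrite cros_starV -big_split; apply: eq_bigr => k _; rewrite /= realizes_cros_at.
Qed.

Lemma realizes_exc : exc (t^-1)%g = #|descent_tops s|.
Proof.
rewrite /exc card_as_sum (reindex_inj (@perm_inj _ t)) /= -sum1_card [RHS]big_mkcond /=.
by apply: eq_bigr => a _; rewrite permK topsE; case: (t a < a).
Qed.

Lemma realizes_depth :
  depth (t^-1)%g + \sum_(b in descent_bottoms s) b = \sum_(a in descent_tops s) a.
Proof.
rewrite -(realizes_tops R) big_imset /=; last by move=> a b _ _; apply: perm_inj.
rewrite /depth (reindex_inj (@perm_inj _ t)) /=.
rewrite (eq_bigl (fun a => a \in descent_tops s)) -?big_split => [|a]; last first.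
  by rewrite permK topsE.
by apply: eq_bigr => a; rewrite topsE permK /=; lia.
Qed.

End Realized.

(** The descent tops are the anti-exceedances of [Phi c s], the descent bottoms
    their images, and [c s] counts its nestings. *)
Lemma Phi_inj (c : {perm 'I_n} -> 'I_n -> nat) :
  (forall s k, c s k <= #|straddling s k|) ->
  (forall s1 s2, descent_tops s1 = descent_tops s2 ->
     descent_bottoms s1 = descent_bottoms s2 -> c s1 =1 c s2 -> s1 = s2) ->
  injective (Phi c).
Proof.
move=> hc c_inj s1 s2 e; have R1 := PhiP (hc s1); have R2 := PhiP (hc s2).
rewrite e in R1; have eG : descent_tops s1 = descent_tops s2.
  apply/setP=> k; rewrite -(realizes_anti_exc k (hc s1) R1).
  exact: (realizes_anti_exc k (hc s2) R2).
apply: c_inj => // [|k].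
  by rewrite -(realizes_tops R1) -(realizes_tops R2) eG.
rewrite -(realizes_nest_at (hc s1) R1).
exact: (realizes_nest_at (hc s2) R2).
Qed.

End Transport.

(** * Descent data and one pattern statistic determine a permutation *)

Section Reconstruction.

Variable n : nat.
Implicit Types (s t : {perm 'I_n}) (k x : 'I_n).

Local Notation pos s := (s^-1)%g.

Definition before s x y := pos s x < pos s y.

(** The number of maximal runs of letters [>= m] that end to the left of the
    letter [x]. *)
Definition drops_before s m x :=
  #|[set p in descents s | (s p.2 < m <= s p.1) && (p.2 <= pos s x)]|.

Definition straddling_before s k x := #|[set p in straddling s k | p.2 <= pos s x]|.

(** This and [drops_beforeE] compute the change of [drops_before] when the letter
    [k] moves from the large letters to the small ones: only the descents having
    [k] as top or as bottom matter. *)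
Lemma drops_before_succ s k x :
  drops_before s k.+1 x = straddling_before s k x +
    ((k \in descent_bottoms s) && (pos s k <= pos s x)).
Proof.
rewrite -(card_eq_cond _ _ (fun b => pos s b <= pos s x)) descent_bottomsE.
rewrite (card_image_sub (fun b => (b == k) && (pos s b <= pos s x))
  (@descents_bottom_inj _ s)).
rewrite /drops_before (card_sub_split _ _ (fun p => s p.2 < k)).
congr (_ + _); congr #|pred_of_set _|; apply/setP=> -[i i'];
  rewrite !inE /descent_at /= ?permK -?val_eqE /=; lia.
Qed.

Lemma drops_beforeE s k x :
  drops_before s k x = straddling_before s k x +
    ((k \in descent_tops s) && before s k x).
Proof.
rewrite -(card_eq_cond _ _ (fun b => before s b x)) descent_topsE.
rewrite (card_image_sub (fun b => (b == k) && before s b x) (@descents_top_inj _ s)).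
rewrite /drops_before (card_sub_split _ _ (fun p => k < s p.1)).
congr (_ + _); congr #|pred_of_set _|; apply/setP=> -[i i'];
  rewrite !inE /descent_at /before /= ?permK -?val_eqE /=; lia.
Qed.

Lemma straddling_before_self s k : straddling_before s k k = pat31_2 s k.
Proof.
rewrite pat31_2E; congr #|pred_of_set _|; apply/setP=> -[i i'].
rewrite [LHS]in_set [RHS]in_set [in RHS]ltn_neqAle /=.
case: (eqVneq (i' : nat) (pos s k)) => [/val_inj ->|]; rewrite ?andbT //=.
by rewrite andbF !inE /= permKV ltnn andbF.
Qed.

(** Take the last position before [j] carrying a letter [>= m]. *)
Lemma drop_exists s m (i j : 'I_n) : i < j -> m <= s i -> s j < m ->
  exists2 p, p \in descents s & [&& s p.2 < m, m <= s p.1, i <= p.1 & p.2 <= j].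
Proof.
move=> ij le_i lt_j; pose P (a : 'I_n) := (a < j) && (m <= s a).
have Pi : P i by rewrite /P ij.
case: (@arg_maxnP _ i P val Pi) => a /andP[aj le_a] amax.
have a'n : a.+1 < n by apply: leq_ltn_trans (ltn_ord j).
pose a' := Ordinal a'n.
have lt_a' : s a' < m.
  case: (eqVneq a' j) => [-> //|]; rewrite -val_eqE /= => ne.
  rewrite ltnNge; apply/negP => le_a'; have := amax a'; rewrite /P le_a' /=; lia.
exists (a, a'); first by rewrite inE /descent_at /= eqxx; lia.
have le_ia : i <= a := amax i Pi.
by rewrite lt_a' le_a le_ia.
Qed.

(** The letter [k] sits in the run of letters [>= k] of index (31-2)_k, so it
    precedes [x < k] exactly when that run ends before [x]. *)
Lemma before_drops s k x : x < k -> before s k x = (pat31_2 s k < drops_before s k x).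
Proof.
move=> lt_xk; rewrite pat31_2E /before; set X := [set p in straddling s k | _].
apply/idP/idP => [kx|].
  have [||p pD /and4P[p1 p2 p3 p4]] := @drop_exists s k _ _ kx; rewrite ?permKV //.
  have pX : p \notin X by move: pD; rewrite !inE /descent_at; lia.
  have <- : #|p |: X| = #|X|.+1 by rewrite cardsU1 pX.
  apply: subset_leq_card; apply/subsetP=> q /setU1P[->|].
    by rewrite in_set pD p1 p2 p4.
  by rewrite !inE; lia.
apply: contraTT; rewrite -!leqNgt leq_eqVlt => /orP[/eqP/val_inj/perm_inj e|xk].
  by rewrite e ltnn in lt_xk.
apply: subset_leq_card; apply/subsetP=> -[i i']; rewrite !inE /descent_at /=.
case: (eqVneq i (pos s k)) => [->|]; rewrite ?permKV; first lia.
by rewrite -(inj_eq (@perm_inj _ s)) permKV -val_eqE /=; lia.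
Qed.

Lemma perm_order_inj s t : (forall x y, (s x < s y) = (t x < t y)) -> s = t.
Proof.
have rankE (u : {perm 'I_n}) x : #|[set y | u y < u x]| = u x.
  rewrite -[RHS](card_lt_ord (u x)) -(card_imset _ (@perm_inj _ u)).
  congr #|pred_of_set _|; apply/setP=> y.
  by rewrite -[y](permKV u) mem_imset ?inE //; apply: perm_inj.
move=> st; apply/permP=> x; apply: val_inj; rewrite /= -[LHS]rankE -[RHS]rankE.
by congr #|pred_of_set _|; apply/setP=> y; rewrite !inE st.
Qed.

(** By induction on [m], the relative order of the letters [< m] and the number of
    runs of letters [>= m] ending before each of them are the same for both
    permutations. *)
Lemma pat31_2_determines s t : descent_tops s = descent_tops t ->
  descent_bottoms s = descent_bottoms t -> pat31_2 s =1 pat31_2 t -> s = t.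
Proof.
move=> eG eB ec; suff main m : m <= n ->
    (forall x y : 'I_n, x < m -> y < m -> before s x y = before t x y) /\
    (forall x : 'I_n, x < m -> drops_before s m x = drops_before t m x).
  apply: invg_inj; apply: perm_order_inj => x y.
  by have [eq_before _] := main n (leqnn n); exact: eq_before.
elim: m => [|m IH] lt_m; first by split.
have [IHb IHd] := IH (ltnW lt_m); pose k := Ordinal lt_m.
have eq_k (x : 'I_n) : x < m -> before s k x = before t k x.
  by move=> xm; rewrite !before_drops // ec (IHd x xm).
have before_sym u x y : x != y -> before u x y = ~~ before u y x.
  move=> ne; rewrite /before -leqNgt ltn_neqAle -[RHS]andTb; congr (_ && _).
  by rewrite val_eqE (inj_eq perm_inj).
have before_refl u x : before u x x = false by rewrite /before ltnn.
have split_k (x : 'I_n) : x < m.+1 -> x = k \/ x < m.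
  by rewrite ltnS leq_eqVlt => /orP[/eqP e|]; [left; apply: val_inj | right].
have lt_neq (x : 'I_n) : x < m -> x != k.
  by apply: contraTneq => ->; rewrite ltnn.
split=> [x y /split_k[->|xm] /split_k[->|ym]|x /split_k[->|xm]].
- by rewrite !before_refl.
- exact: eq_k.
- by rewrite before_sym ?lt_neq // eq_k // -before_sym ?lt_neq.
- exact: IHb.
- by rewrite (drops_before_succ s k) (drops_before_succ t k) !straddling_before_self
    ec eB !leqnn.
- have leE (u : {perm 'I_n}) : (pos u k <= pos u x) = before u k x.
    rewrite /before leq_eqVlt val_eqE (inj_eq perm_inj).
    by rewrite eq_sym (negPf (lt_neq x xm)).
  rewrite (drops_before_succ s k) (drops_before_succ t k) !leE eB eq_k //.
  have := IHd x xm; rewrite (drops_beforeE s k) (drops_beforeE t k) eG eq_k //.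
  by move/addIn ->.
Qed.

(** The sum of the two statistics depends on descent tops and bottoms only. *)
Lemma pat2_31_determines s t : descent_tops s = descent_tops t ->
  descent_bottoms s = descent_bottoms t -> pat2_31 s =1 pat2_31 t -> s = t.
Proof.
move=> eG eB ec; apply: pat31_2_determines => // k; apply: (@addIn (pat2_31 s k)).
rewrite pat_add ec pat_add; apply: (@addIn #|[set b in descent_bottoms s | k <= b]|).
by rewrite {2}eB !straddling_tops eG.
Qed.

End Reconstruction.

(** * Exchange of nestings and crossings *)

Theorem theorem8p3 (n : nat) (hn : 0 < n) :
  bijective (@Theta n) /\
  (forall s : {perm 'I_n},
     (exc s, nest_star s, cros_star s, depth s) =
     (exc (Theta s), cros_star (Theta s), nest_star (Theta s), depth (Theta s))).
Proof.
have c1_le (s : {perm 'I_n}) k : pat31_2 s k <= #|straddling s k|.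
  by rewrite -pat_add leq_addr.
have c2_le (s : {perm 'I_n}) k : pat2_31 s k <= #|straddling s k|.
  by rewrite -pat_add leq_addl.
have C_inj : injective (@Phi_C n) := Phi_inj c1_le (@pat31_2_determines n).
have SZ_inj : injective (@Phi_SZ n) := Phi_inj c2_le (@pat2_31_determines n).
split.
  apply: injF_bij; apply: inj_comp; last exact: invg_inj.
  apply: inj_comp; first exact: invg_inj.
  apply: inj_comp SZ_inj _; exact: finv_inj.
move=> s; have [r [t1 [t2 [R1 R2 sE thetaE]]]] : exists r t1 t2,
    [/\ realizes (pat31_2 r) r t1, realizes (pat2_31 r) r t2,
        s = (t1^-1)%g & Theta s = (t2^-1)%g].
  pose r := finv (@Phi_C n) (s^-1)%g; exists r, (Phi_C r), (Phi_SZ r); split.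
  - exact: PhiP (c1_le r).
  - exact: PhiP (c2_le r).
  - by rewrite (f_finv C_inj) invgK.
  - by rewrite /Theta /Phi_star /iota_perm /=.
have total : \sum_k #|straddling r k| = \sum_k pat31_2 r k + \sum_k pat2_31 r k.
  by rewrite -big_split; apply: eq_bigr => k _; rewrite /= pat_add.
have cros1 := realizes_cros_star (c1_le r) R1.
have cros2 := realizes_cros_star (c2_le r) R2.
have depth1 := realizes_depth (c1_le r) R1.
have depth2 := realizes_depth (c2_le r) R2.
rewrite thetaE sE (realizes_exc (c1_le r) R1) (realizes_exc (c2_le r) R2).
rewrite (realizes_nest_star (c1_le r) R1) (realizes_nest_star (c2_le r) R2).
by congr (_, _, _, _); lia.
Qed.
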